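(* Let $\rho\in\mathcal R$ and $A_\rho\in\mathcal B(H_\rho)$. Put $\mathcal N_\rho=\{N\in\mathcal B(\mathcal H): NQ_\rho=0\}$. Then $$\operatorname{Ext}_\rho(A_\rho)=\widetilde A_\rho^{\,0}+\mathcal N_\rho .$$ Moreover, $\mathcal N_\rho$ is isometrically isomorphic to $\mathcal B(Z_\rho,\mathcal H)$ (both with the operator norm). Hence $\operatorname{Ext}_\rho(A_\rho)$ is an affine space modeled on $\mathcal B(Z_\rho,\mathcal H)$.
   Context: Let $X=\mathbb R^n$ ($n\ge 1$) with its Borel $\sigma$-algebra and Lebesgue measure $\lambda$; functions are complex-valued. Let $\mathcal H=L^2(X,\lambda)$; $\mathcal B(E,F)$ denotes the bounded linear operators from $E$ to $F$, and $\mathcal B(E)=\mathcal B(E,E)$. Let $\mathcal R=\{\rho\in L^1(X,\lambda):\rho\ge 0\ \lambda\text{-a.e.},\ \int_X\rho\,d\lambda=1\}$. For $\rho\in\mathcal R$ let $H_\rho=L^2(X,\rho\,d\lambda)$, $V_\rho=\{u\in\mathcal H:u=0\ \lambda\text{-a.e. on }\{\rho=0\}\}$ and $Z_\rho=V_\rho^\perp=\{u\in\mathcal H:u=0\ \lambda\text{-a.e. on }\{\rho>0\}\}$. The map $U_\rho:H_\rho\to V_\rho$, $U_\rho[f]_\rho=\sqrt\rho\,f$, is unitary. $Q_\rho u=\mathbf 1_{\{\rho>0\}}u$ is the orthogonal projection of $\mathcal H$ onto $V_\rho$. For $A_\rho\in\mathcal B(H_\rho)$, the aligned operator is $A_\rho^\sharp=U_\rho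 A_\rho U_\rho^{-1}:V_\rho\to V_\rho$. An ambient extension of $A_\rho$ is an operator $\widetilde A\in\mathcal B(\mathcal H)$ with $\widetilde A|_{V_\rho}=A_\rho^\sharp$; the set of all ambient extensions is $\operatorname{Ext}_\rho(A_\rho)$. The zero-defect extension is $\widetilde A_\rho^{\,0}=A_\rho^\sharp Q_\rho\in\mathcal B(\mathcal H)$. *)

(* Defs.v *)
From HB Require Import structures.
From mathcomp Require Import all_boot all_order all_algebra.
From mathcomp Require Import complex.
From mathcomp Require Import all_classical all_reals all_analysis.
From mathcomp Require Import measurable_realfun.

Set Implicit Arguments.
Unset Strict Implicit.
Unset Printing Implicit Defensive.

Import Order.TTheory GRing.Theory Num.Theory.
Import numFieldNormedType.Exports.

Local Open Scope classical_set_scope.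
Local Open Scope ring_scope.
Local Open Scope complex_scope.

Section normC.
Variable R : realType.

Lemma realCD (a b : R) : (a + b)%:C = a%:C + b%:C.
Proof. exact: rmorphD. Qed.

Lemma realCM (a b : R) : (a * b)%:C = a%:C * b%:C.
Proof. exact: rmorphM. Qed.

Lemma ge0_RRe (z : R[i]) : 0 <= z -> (complex.Re z)%:C = z.
Proof. by move=> z0; apply: RRe_real; rewrite realE z0. Qed.

Lemma Re_norm_ge0 (E : normedModType R[i]) (x : E) : 0 <= complex.Re `|x|.
Proof. by rewrite -ler0c ge0_RRe. Qed.

End normC.

Section bounded_op.
Variables (R : realType) (E F : normedModType R[i]).

(* Scalars, hence also the norms of a [normedModType R[i]], live in [R[i]];
   norms are the nonnegative reals embedded in [R[i]]. *)
Definition bounded_op_pred : {pred E -> F} := fun f =>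
  `[< linear f /\ exists M : R, forall x, `|f x| <= M%:C * `|x| >].

Lemma bounded_op_submod_closed : submod_closed bounded_op_pred.
Proof.
split=> [|a f g /asboolP[lf [M fM]] /asboolP[lg [N gN]]]; apply/asboolP.
  split=> [b x y|]; first by rewrite scaler0 addr0.
  by exists 0 => x; rewrite normr0 mul0r.
split=> [b x y|].
  change (a *: f (b *: x + y) + g (b *: x + y) =
          b *: (a *: f x + g x) + (a *: f y + g y)).
  rewrite lf lg scalerDr scalerA mulrC -scalerA [b *: (_ + _)]scalerDr.
  by rewrite !addrA; congr (_ + _); rewrite -!addrA; congr (_ + _); exact: addrC.
exists (complex.Re `|a| * M + N) => x.
change (`|a *: f x + g x| <= (complex.Re `|a| * M + N)%:C * `|x|).
rewrite realCD realCM ge0_RRe// mulrDl (le_trans (ler_normD _ _))//.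
by rewrite lerD// normrZ -mulrA ler_wpM2l.
Qed.

HB.instance Definition _ := GRing.isSubmodClosed.Build R[i] (E -> F)
  bounded_op_pred bounded_op_submod_closed.

Record bounded_op := BoundedOp {
  bounded_op_fun :> E -> F ;
  bounded_opP : bounded_op_fun \in bounded_op_pred }.

HB.instance Definition _ := [isSub for bounded_op_fun].
HB.instance Definition _ := [Choice of bounded_op by <:].
HB.instance Definition _ := [SubChoice_isSubLmodule of bounded_op by <:].

Lemma bounded_op_linear (f : bounded_op) : linear f.
Proof. by have /asboolP[] := bounded_opP f. Qed.

HB.instance Definition _ (f : bounded_op) :=
  GRing.isLinear.Build R[i] E F _ (f : E -> F) (bounded_op_linear f).

Lemma bounded_op_bound (f : bounded_op) :
  exists2 M : R, 0 <= M & forall x, `|f x| <= M%:C * `|x|.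
Proof.
have /asboolP[_ [M fM]] := bounded_opP f.
exists `|M| => // x; apply: (le_trans (fM x)).
by rewrite ler_wpM2r// lecR ler_norm.
Qed.

Lemma bounded_opE (f g : bounded_op) : f =1 g -> f = g.
Proof. by move=> fg; apply: val_inj; apply/funext. Qed.

Definition unit_ball_values (f : bounded_op) : set R :=
  [set complex.Re `|f x| | x in [set x : E | `|x| <= 1]].

Definition op_norm (f : bounded_op) : R[i] := (sup (unit_ball_values f))%:C.

Lemma has_sup_unit_ball_values f : has_sup (unit_ball_values f).
Proof.
split; first by exists (complex.Re `|f 0|), 0 => //=; rewrite normr0.
have [M M0 fM] := bounded_op_bound f.
exists M => _ [x /= x1 <-]; rewrite -lecR ge0_RRe//.
by rewrite (le_trans (fM x))// ler_piMr// lecR.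
Qed.

Lemma op_norm_ge0 f : 0 <= op_norm f.
Proof.
rewrite lecR; apply: (@le_trans _ _ (complex.Re `|f 0|)).
  exact: Re_norm_ge0.
apply: ub_le_sup; first by case: (has_sup_unit_ball_values f).
by exists 0 => //=; rewrite normr0.
Qed.

Lemma le_op_norm (f : bounded_op) x : `|f x| <= op_norm f * `|x|.
Proof.
have [->|x0] := eqVneq x 0; first by rewrite linear0 !normr0 mulr0.
have nx0 : 0 < `|x| by rewrite normr_gt0.
rewrite -ler_pdivrMr// mulrC.
have -> : `|x|^-1 * `|f x| = `|f (`|x|^-1 *: x)|.
  by rewrite linearZ normrZ ger0_norm ?invr_ge0.
rewrite -[leLHS]ge0_RRe// lecR; apply: ub_le_sup.
  by case: (has_sup_unit_ball_values f).
exists (`|x|^-1 *: x) => //=.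
by rewrite normrZ ger0_norm ?invr_ge0// mulVf ?gt_eqF.
Qed.

Lemma op_norm_le (f : bounded_op) (M : R[i]) :
  0 <= M -> (forall x, `|f x| <= M * `|x|) -> op_norm f <= M.
Proof.
move=> M0 fM; rewrite -[M]ge0_RRe// lecR.
apply: ge_sup; first by case: (has_sup_unit_ball_values f).
move=> _ [x /= x1 <-]; rewrite -lecR !ge0_RRe//.
by rewrite (le_trans (fM x))// ler_piMr.
Qed.

Lemma op_normD f g : op_norm (f + g) <= op_norm f + op_norm g.
Proof.
apply: op_norm_le => [|x]; first by rewrite addr_ge0// op_norm_ge0.
change (`|f x + g x| <= (op_norm f + op_norm g) * `|x|).
by rewrite mulrDl (le_trans (ler_normD _ _))// lerD// le_op_norm.
Qed.

Let op_normZ_le a f : op_norm (a *: f) <= `|a| * op_norm f.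
Proof.
apply: op_norm_le => [|x]; first by rewrite mulr_ge0// op_norm_ge0.
change (`|a *: f x| <= `|a| * op_norm f * `|x|).
by rewrite normrZ -mulrA ler_wpM2l// le_op_norm.
Qed.

Lemma op_norm0_eq0 f : op_norm f = 0 -> f = 0.
Proof.
move=> f0; apply: bounded_opE => x; apply/eqP.
by rewrite -normr_le0 (le_trans (le_op_norm f x))// f0 mul0r.
Qed.

Lemma op_normZ a f : op_norm (a *: f) = `|a| * op_norm f.
Proof.
apply/eqP; rewrite eq_le op_normZ_le/=.
have [->|a0] := eqVneq a 0.
  by rewrite normr0 mul0r op_norm_ge0.
rewrite -ler_pdivlMl ?normr_gt0// -normfV.
by rewrite -[f in leLHS](scalerK a0) op_normZ_le.
Qed.

HB.instance Definition _ := Lmodule_isNormed.Build R[i] bounded_op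
  op_normD op_normZ op_norm0_eq0.

Lemma op_normE (f : bounded_op) : `|f| = op_norm f.
Proof. by []. Qed.

End bounded_op.

Section composition.
Variables (R : realType) (E F G : normedModType R[i]).

Lemma bounded_comp_subproof (f : bounded_op F G) (g : bounded_op E F) :
  (fun x => f (g x)) \in @bounded_op_pred R E G.
Proof.
apply/asboolP; split=> [a x y|]; first by rewrite !linearP.
have [M M0 fM] := bounded_op_bound f.
have [N N0 gN] := bounded_op_bound g.
exists (M * N) => x; rewrite (le_trans (fM _))// realCM -mulrA ler_wpM2l//.
by rewrite lecR.
Qed.

Definition bounded_comp (f : bounded_op F G) (g : bounded_op E F) :
  bounded_op E G := BoundedOp (bounded_comp_subproof f g).

End composition.

Notation "f '\oB' g" := (bounded_comp f g)
  (at level 50, left associativity) : ring_scope.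

Section subspace.
Variables (R : realType) (E : normedModType R[i]) (S : submodClosed E).

Record subspace_of := SubspaceOf {
  subspace_val : E ;
  subspace_valP : subspace_val \in S }.

HB.instance Definition _ := [isSub for subspace_val].
HB.instance Definition _ := [Choice of subspace_of by <:].
HB.instance Definition _ := [SubChoice_isSubLmodule of subspace_of by <:].

Let subspace_norm (x : subspace_of) : R[i] := `|subspace_val x|.

Let subspace_normD x y : subspace_norm (x + y) <= subspace_norm x + subspace_norm y.
Proof. exact: ler_normD. Qed.

Let subspace_normZ a x : subspace_norm (a *: x) = `|a| * subspace_norm x.
Proof. exact: normrZ. Qed.

Let subspace_norm0_eq0 x : subspace_norm x = 0 -> x = 0.
Proof. by move/normr0_eq0 => x0; apply: val_inj; rewrite /= x0. Qed.

HB.instance Definition _ := Lmodule_isNormed.Build R[i] subspace_of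
  subspace_normD subspace_normZ subspace_norm0_eq0.

Lemma subspace_normE (x : subspace_of) : `|x| = `|subspace_val x|.
Proof. by []. Qed.

Lemma subspace_incl_subproof : subspace_val \in @bounded_op_pred R subspace_of E.
Proof.
apply/asboolP; split=> //; exists 1 => x.
by rewrite mul1r.
Qed.

Definition subspace_incl : bounded_op subspace_of E :=
  BoundedOp subspace_incl_subproof.

Lemma corestrict_subproof (F : normedModType R[i]) (f : bounded_op F E)
    (fS : forall x, f x \in S) :
  (fun x => SubspaceOf (fS x)) \in @bounded_op_pred R F subspace_of.
Proof.
apply/asboolP; split=> [a x y|].
  by apply: val_inj; rewrite /= linearP.
have [M M0 fM] := bounded_op_bound f.
by exists M => x; exact: fM.
Qed.

Definition corestrict (F : normedModType R[i]) (f : bounded_op F E)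
    (fS : forall x, f x \in S) : bounded_op F subspace_of :=
  BoundedOp (corestrict_subproof fS).

End subspace.

Definition isometric_isomorphism (R : realType) (E F : normedModType R[i])
    (f : {linear E -> F}) : Prop :=
  bijective f /\ forall x, `|f x| = `|x|.

(* [S] is nonempty and [M], acting on [S] by the translations [p |-> p + j m],
   acts freely and transitively. For a linear [j] the action axioms
   [p + j 0 = p] and [p + j (m + m') = (p + j m) + j m'] are automatic. *)
Definition affine_space_modeled_on (K : pzRingType) (M W : lmodType K)
    (j : M -> W) (S : set W) : Prop :=
  [/\ S !=set0,
      forall p m, S p -> S (p + j m) &
      forall p q, S p -> S q -> exists! m, q = p + j m].

Section L2fun.
Context d (T : measurableType d) (R : realType).
Variable mu : {measure set T -> \bar R}.
Implicit Types f g : T -> R[i].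

Definition cmeasurable f :=
  measurable_fun setT (fun x => complex.Re (f x)) /\
  measurable_fun setT (fun x => complex.Im (f x)).

Definition modulus f : T -> R := fun x => Normc.normc (f x).

(* L^2 seminorm of a complex-valued function *)
Definition N2 f : \bar R := ('N[mu]_2%:E[EFin \o modulus f])%E.

Definition L2fun_pred : {pred T -> R[i]} := fun f =>
  `[< cmeasurable f /\ finite_norm mu 2%:E (modulus f) >].

Lemma modulus_ge0 f x : 0 <= modulus f x.
Proof. by rewrite /modulus; case: (f x) => a b /=; exact: sqrtr_ge0. Qed.

Lemma sqr_modulus f x :
  modulus f x ^+ 2 = complex.Re (f x) ^+ 2 + complex.Im (f x) ^+ 2.
Proof.
rewrite /modulus; case: (f x) => a b /=.
by rewrite sqr_sqrtr// addr_ge0// sqr_ge0.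
Qed.

Lemma measurable_modulus f : cmeasurable f -> measurable_fun setT (modulus f).
Proof.
move=> [mr mi].
have -> : modulus f = (fun x => Num.sqrt
    (complex.Re (f x) ^+ 2 + complex.Im (f x) ^+ 2)).
  by apply/funext => x; rewrite /modulus; case: (f x).
have -> : (fun x => Num.sqrt (complex.Re (f x) ^+ 2 + complex.Im (f x) ^+ 2)) =
  (@Num.sqrt R) \o (fun x => complex.Re (f x) ^+ 2 + complex.Im (f x) ^+ 2) by [].
apply: measurableT_comp.
  exact: continuous_measurable_fun (@sqrt_continuous R).
by apply: measurable_funD; apply: measurable_funX.
Qed.

Lemma cmeasurableD f g : cmeasurable f -> cmeasurable g ->
  cmeasurable (fun x => f x + g x).
Proof.
move=> [fr fi] [gr gi]; split.
  rewrite (_ : (fun x => _) = (fun x => complex.Re (f x) + complex.Re (g x))).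
    exact: measurable_funD.
  by apply/funext => x; case: (f x) => ? ?; case: (g x).
rewrite (_ : (fun x => _) = (fun x => complex.Im (f x) + complex.Im (g x))).
  exact: measurable_funD.
by apply/funext => x; case: (f x) => ? ?; case: (g x).
Qed.

Lemma cmeasurableM f g : cmeasurable f -> cmeasurable g ->
  cmeasurable (fun x => f x * g x).
Proof.
move=> [fr fi] [gr gi]; split.
  rewrite (_ : (fun x => _) = (fun x => complex.Re (f x) * complex.Re (g x) -
      complex.Im (f x) * complex.Im (g x))).
    by apply: measurable_funB; exact: measurable_funM.
  by apply/funext => x; case: (f x) => ? ?; case: (g x).
rewrite (_ : (fun x => _) = (fun x => complex.Re (f x) * complex.Im (g x) +
      complex.Im (f x) * complex.Re (g x))).
  by apply: measurable_funD; exact: measurable_funM.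
by apply/funext => x; case: (f x) => ? ?; case: (g x).
Qed.

Lemma cmeasurable_cst (a : R[i]) : cmeasurable (fun=> a).
Proof. by split; exact: measurable_cst. Qed.

Lemma cmeasurable_real (m : T -> R) : measurable_fun setT m ->
  cmeasurable (fun x => (m x)%:C).
Proof. by move=> mm; split => //; exact: measurable_cst. Qed.

Lemma N2E f : N2 f = ((\int[mu]_x (modulus f x ^+ 2)%:E) `^ 2^-1)%E.
Proof.
rewrite /N2 unlock /Lnorm; congr (_ `^ _)%E; apply: eq_integral => x _ /=.
rewrite ger0_norm ?modulus_ge0// powR_mulrn ?modulus_ge0//.
Qed.

Lemma sqr_integral_ge0 f : (0 <= \int[mu]_x (modulus f x ^+ 2)%:E)%E.
Proof. by apply: integral_ge0 => x _; rewrite lee_fin sqr_ge0. Qed.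

Lemma sqr_integralE f : (\int[mu]_x (modulus f x ^+ 2)%:E = N2 f `^ 2)%E.
Proof.
rewrite N2E -poweRrM mulVf ?pnatr_eq0// poweRe1//.
exact: sqr_integral_ge0.
Qed.

Lemma measurable_sqr_modulus f : cmeasurable f ->
  measurable_fun setT (fun x => (modulus f x ^+ 2)%:E).
Proof.
move=> mf; apply/measurable_EFinP; apply: measurable_funX.
exact: measurable_modulus.
Qed.

Lemma le_N2 f g : cmeasurable f -> cmeasurable g ->
  (forall x, modulus f x <= modulus g x) -> (N2 f <= N2 g)%E.
Proof.
move=> mf mg fg; rewrite !N2E; apply: gt0_ler_poweR; rewrite ?invr_ge0//.
- by rewrite in_itv/= leey sqr_integral_ge0.
- by rewrite in_itv/= leey sqr_integral_ge0.
- apply: ge0_le_integral => //.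
  + by move=> x _; rewrite lee_fin sqr_ge0.
  + exact: measurable_sqr_modulus.
  + exact: measurable_sqr_modulus.
  + move=> x _; rewrite lee_fin ler_pXn2r// nnegrE; exact: modulus_ge0.
Qed.

Lemma ae_eq_N2 f g : cmeasurable f -> cmeasurable g ->
  {ae mu, forall x, f x = g x} -> N2 f = N2 g.
Proof.
move=> mf mg fg; rewrite !N2E; congr (_ `^ _)%E.
apply: ae_eq_integral => //.
- exact: measurable_sqr_modulus.
- exact: measurable_sqr_modulus.
- by apply: filterS fg => x fgx _; rewrite /modulus fgx.
Qed.

Lemma N2_ge0 f : (0 <= N2 f)%E.
Proof. exact: Lnorm_ge0. Qed.

Lemma N2D f g : cmeasurable f -> cmeasurable g ->
  (N2 (fun x => (f x + g x)%R) <= N2 f + N2 g)%E.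
Proof.
move=> mf mg.
apply: le_trans (minkowski_EFin _ (measurable_modulus mf)
  (measurable_modulus mg) _); last by rewrite ler1n.
rewrite {1}/N2.
pose h : T -> R[i] := fun x => (modulus f x + modulus g x)%:C.
have hE : modulus h = (modulus f \+ modulus g)%R.
  apply/funext => x; rewrite /h {1}/modulus /= expr0n /= addr0 sqrtr_sqr.
  by rewrite ger0_norm// addr_ge0// modulus_ge0.
have mh : cmeasurable h.
  by apply: cmeasurable_real; apply: measurable_funD; exact: measurable_modulus.
have := le_N2 (cmeasurableD mf mg) mh.
rewrite /N2 hE; apply => x.
rewrite /modulus /=.
exact: (@le_normcD R).
Qed.

Lemma N2Z (a : R[i]) f : cmeasurable f -> (N2 f < +oo)%E ->
  N2 (fun x => a * f x) = ((Normc.normc a)%:E * N2 f)%E.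
Proof.
move=> mf foo.
have fP : modulus f \in Lfun mu 2%:E.
  by apply/andP; split; rewrite inE/=; [exact: measurable_modulus|exact: foo].
have := LnormZ (Lfun_Sub (lee1n 2) fP) (Normc.normc a).
rewrite ger0_norm; last by case: (a) => ? ? /=; exact: sqrtr_ge0.
move=> <-; rewrite /N2; congr Lnorm; apply/funext => x /=.
by rewrite /modulus Normc.normcM.
Qed.

Lemma N2_eq0 f : cmeasurable f -> N2 f = 0%E -> {ae mu, forall x, f x = 0}.
Proof.
move=> mf /Lnorm_eq0_eq0; rewrite lte_fin ltr0n => /(_ _ isT)[].
  by apply/measurable_EFinP; exact: measurable_modulus.
move=> N [mN N0 sN]; exists N; split => // x fx0; apply: sN => /= /(_ I).
by move=> [] /Normc.eq0_normc.
Qed.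

Lemma N2_null f : cmeasurable f -> {ae mu, forall x, f x = 0} -> N2 f = 0%E.
Proof.
move=> mf f0.
have -> : N2 f = N2 (fun=> 0) by apply: ae_eq_N2 => //; exact: cmeasurable_cst.
have E0 : (fun x => (modulus (fun=> 0) x ^+ 2)%:E) = cst 0%E :> (T -> \bar R).
  by apply/funext => x; rewrite /modulus /= expr0n /= addr0 sqrtr0 expr0n.
by rewrite N2E E0 integral0 poweR0r// invr_eq0 pnatr_eq0.
Qed.

Lemma L2fun_submod_closed : submod_closed L2fun_pred.
Proof.
split=> [|a f g /asboolP[mf foo] /asboolP[mg goo]]; apply/asboolP.
  have m0 : cmeasurable 0 by exact: (cmeasurable_cst 0).
  have n0 : {ae mu, forall x, (0 : T -> R[i]) x = 0} by exact/nearW.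
  by split => //; rewrite /finite_norm -/(N2 0) (N2_null m0 n0).
split.
  exact: (cmeasurableD (cmeasurableM (cmeasurable_cst a) mf) mg).
rewrite /finite_norm.
apply: le_lt_trans (N2D (cmeasurableM (cmeasurable_cst a) mf) mg) _.
rewrite N2Z// lte_add_pinfty// lte_mul_pinfty// lee_fin.
by case: (a) => ? ? /=; exact: sqrtr_ge0.
Qed.

HB.instance Definition _ := GRing.isSubmodClosed.Build R[i] (T -> R[i])
  L2fun_pred L2fun_submod_closed.

Record L2fun := MkL2fun {
  L2fun_val :> T -> R[i] ;
  L2funP : L2fun_val \in L2fun_pred }.

HB.instance Definition _ := [isSub for L2fun_val].
HB.instance Definition _ := [Choice of L2fun by <:].
HB.instance Definition _ := [SubChoice_isSubLmodule of L2fun by <:].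

Lemma L2fun_cmeasurable (f : L2fun) : cmeasurable f.
Proof. by have /asboolP[] := L2funP f. Qed.

Lemma L2fun_fin (f : L2fun) : (N2 f < +oo)%E.
Proof. by have /asboolP[] := L2funP f. Qed.

Definition ae_null : {pred L2fun} := fun f : L2fun =>
  `[< {ae mu, forall x, f x = 0} >].

Lemma ae_null_submod_closed : submod_closed ae_null.
Proof.
split=> [|a f g /asboolP f0 /asboolP g0]; apply/asboolP; first exact/nearW.
move: f0 g0; apply: filterS2 => x fx gx.
by change (a * f x + g x = 0); rewrite fx gx mulr0 addr0.
Qed.

HB.instance Definition _ := GRing.isSubmodClosed.Build R[i] L2fun
  ae_null ae_null_submod_closed.

End L2fun.

Local Open Scope quotient_scope.

(* L^2(T, mu): square-integrable measurable functions T -> C modulo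
   mu-almost everywhere equality. *)
Section L2.
Context d (T : measurableType d) (R : realType).
Variable mu : {measure set T -> \bar R}.

Definition L2 : Type := Quotient.quot (@ae_null d T R mu).
HB.instance Definition _ := GRing.Zmodule.on L2.

Definition L2_class (f : L2fun mu) : L2 := \pi_(Quotient.quot (@ae_null d T R mu)) f.
Definition L2_repr (u : L2) : L2fun mu := repr (u : Quotient.quot (@ae_null d T R mu)).
Coercion L2_repr : L2 >-> L2fun.

Lemma L2_reprK : cancel L2_repr L2_class.
Proof. exact: reprK. Qed.

Lemma L2_classP (f g : L2fun mu) :
  L2_class f = L2_class g <-> {ae mu, forall x, f x = g x}.
Proof.
have -> : {ae mu, forall x, f x = g x} <-> ((f - g) \in @ae_null d T R mu).
  split.
    move=> fg; apply/asboolP; apply: filterS fg => x fgx.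
    by change (f x - g x = 0); rewrite fgx subrr.
  move=> /asboolP fg; apply: filterS fg => x.
  by change (f x - g x = 0 -> f x = g x) => /eqP; rewrite subr_eq0 => /eqP.
rewrite Quotient.idealrBE; split => [/eqP|/eqP]//.
Qed.

Lemma L2_eqP (u v : L2) : u = v <-> {ae mu, forall x, u x = v x}.
Proof. by rewrite -L2_classP !L2_reprK. Qed.

Lemma L2_classE (f : L2fun mu) : {ae mu, forall x, L2_class f x = f x}.
Proof. by apply/L2_classP; rewrite L2_reprK. Qed.

Lemma L2_classD (f g : L2fun mu) : L2_class (f + g) = L2_class f + L2_class g.
Proof. exact: pi_addr. Qed.

Lemma L2_class0 : L2_class 0 = 0.
Proof. exact: pi_zeror. Qed.

Lemma L2_zeroE : {ae mu, forall x, (0 : L2) x = 0}.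
Proof. by rewrite -L2_class0; exact: L2_classE. Qed.

Lemma L2_addE (u v : L2) : {ae mu, forall x, (u + v : L2) x = u x + v x}.
Proof.
rewrite -[u in (u + _)]L2_reprK -[v in (_ + v)]L2_reprK -L2_classD.
exact: L2_classE.
Qed.

Definition L2_scale (a : R[i]) (u : L2) : L2 := L2_class (a *: (u : L2fun mu)).

Lemma L2_scale_class a (f : L2fun mu) :
  L2_scale a (L2_class f) = L2_class (a *: f).
Proof.
apply/L2_classP; apply: filterS (L2_classE f) => x fx.
by change (a * L2_class f x = a * f x); rewrite fx.
Qed.

Let L2_scaleA a b u : L2_scale a (L2_scale b u) = L2_scale (a * b) u.
Proof. by rewrite -[u]L2_reprK !L2_scale_class scalerA. Qed.

Let L2_scale1 : left_id 1 L2_scale.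
Proof. by move=> u; rewrite -[u]L2_reprK L2_scale_class scale1r. Qed.

Let L2_scaleDr : right_distributive L2_scale +%R.
Proof.
move=> a u v; rewrite -[u]L2_reprK -[v]L2_reprK -L2_classD !L2_scale_class.
by rewrite scalerDr L2_classD.
Qed.

Let L2_scaleDl u : {morph L2_scale^~ u : a b / a + b}.
Proof.
move=> a b; rewrite -[u]L2_reprK !L2_scale_class scalerDl.
exact: L2_classD.
Qed.

HB.instance Definition _ := GRing.Zmodule_isLmodule.Build R[i] L2
  L2_scaleA L2_scale1 L2_scaleDr L2_scaleDl.

Lemma L2_scaleE a (u : L2) : {ae mu, forall x, (a *: u : L2) x = a * u x}.
Proof. exact: L2_classE. Qed.

Definition L2_norm (u : L2) : R[i] := (fine (N2 mu u))%:C.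

Lemma L2_norm_fineK (u : L2) : (fine (N2 mu u))%:E = N2 mu u.
Proof. by rewrite fineK// ge0_fin_numE ?N2_ge0// L2fun_fin. Qed.

Let L2_normD (u v : L2) : L2_norm (u + v) <= L2_norm u + L2_norm v.
Proof.
rewrite /L2_norm -realCD lecR -lee_fin EFinD !L2_norm_fineK.
rewrite (@ae_eq_N2 _ _ _ mu _ (fun x => u x + v x)).
- by apply: N2D; exact: L2fun_cmeasurable.
- exact: L2fun_cmeasurable.
- by apply: cmeasurableD; exact: L2fun_cmeasurable.
- exact: L2_addE.
Qed.

Let L2_normZ a (u : L2) : L2_norm (a *: u) = `|a| * L2_norm u.
Proof.
have -> : `|a| = (Normc.normc a)%:C by [].
rewrite /L2_norm -realCM; congr (_%:C).
rewrite (@ae_eq_N2 _ _ _ mu _ (fun x => a * u x)).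
- rewrite (N2Z a (L2fun_cmeasurable u) (L2fun_fin u)).
  by rewrite -[in LHS]L2_norm_fineK -EFinM.
- exact: L2fun_cmeasurable.
- by apply: cmeasurableM; [exact: cmeasurable_cst|exact: L2fun_cmeasurable].
- exact: L2_scaleE.
Qed.

Let L2_norm0_eq0 (u : L2) : L2_norm u = 0 -> u = 0.
Proof.
move=> /complexI u0; rewrite -[u]L2_reprK.
rewrite -L2_class0.
apply/L2_classP; apply: N2_eq0; first exact: L2fun_cmeasurable.
by rewrite -L2_norm_fineK u0.
Qed.

HB.instance Definition _ := Lmodule_isNormed.Build R[i] L2
  L2_normD L2_normZ L2_norm0_eq0.

Lemma L2_normE (u : L2) : `|u| = (fine (N2 mu u))%:C.
Proof. by []. Qed.

End L2.

(* The operator [f] |-> [m f] from L^2(mu) to L^2(nu), for a pointwise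
   multiplier m that does not increase the norm. It respects the a.e. classes:
   see mulop_fun_ae. *)
Section multiplication_operator.
Context d (T : measurableType d) (R : realType).
Variables mu nu : {measure set T -> \bar R}.
Variable m : T -> R.
Hypothesis mm : measurable_fun setT m.
Hypothesis m_le : forall f : T -> R[i], cmeasurable f ->
  (N2 nu (fun x => (m x)%:C * f x)%R <= N2 mu f)%E.

Lemma mulop_fun_subproof (f : L2fun mu) :
  (fun x => (m x)%:C * f x) \in L2fun_pred nu.
Proof.
apply/asboolP; split.
  by apply: cmeasurableM; [exact: cmeasurable_real|exact: L2fun_cmeasurable].
apply: le_lt_trans (L2fun_fin f).
by apply: m_le; exact: L2fun_cmeasurable.
Qed.

Definition mulop_fun (f : L2fun mu) : L2fun nu := MkL2fun (mulop_fun_subproof f).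

Lemma mulop_fun_ae (f g : L2fun mu) : {ae mu, forall x, f x = g x} ->
  {ae nu, forall x, (m x)%:C * f x = (m x)%:C * g x}.
Proof.
move=> fg.
have mh : cmeasurable (fun x => f x - g x) by exact: (L2fun_cmeasurable (f - g)).
have h0 : N2 mu (fun x => f x - g x) = 0%E.
  by apply: N2_null => //; apply: filterS fg => x ->; rewrite subrr.
have k0 : N2 nu (fun x => (m x)%:C * (f x - g x)) = 0%E.
  by apply/eqP; rewrite eq_le N2_ge0 andbT -h0; exact: m_le.
have mk : cmeasurable (fun x => (m x)%:C * (f x - g x)).
  by apply: cmeasurableM => //; exact: cmeasurable_real.
apply: filterS (N2_eq0 mk k0) => x /eqP.
by rewrite mulrBr subr_eq0 => /eqP.
Qed.

Lemma mulop_subproof : (fun u : L2 mu => L2_class (mulop_fun u)) \in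
  @bounded_op_pred R (L2 mu) (L2 nu).
Proof.
apply/asboolP; split=> [a u v|].
  apply/L2_eqP.
  pose w : L2fun mu := a *: L2_repr u + L2_repr v.
  have uvw : {ae mu, forall x, L2_repr (a *: u + v) x = w x}.
    by apply: filterS2 (L2_addE (a *: u) v) (L2_scaleE a u) => x -> ->.
  pose mu' := L2_class (mulop_fun (L2_repr u)).
  pose mv' := L2_class (mulop_fun (L2_repr v)).
  have lhsE : {ae nu, forall x, L2_repr (L2_class (mulop_fun
      (L2_repr (a *: u + v)))) x = (m x)%:C * (a * L2_repr u x + L2_repr v x)}.
    apply: filterS2 (mulop_fun_ae uvw)
      (L2_classE (mulop_fun (L2_repr (a *: u + v)))) => x E1 E2.
    by rewrite E2; exact: E1.
  have rhsE : {ae nu, forall x, L2_repr (a *: mu' + mv') x =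
      a * L2_repr mu' x + L2_repr mv' x}.
    by apply: filterS2 (L2_addE (a *: mu') mv') (L2_scaleE a mu') => x -> ->.
  have rhsE' : {ae nu, forall x, L2_repr (a *: mu' + mv') x =
      a * ((m x)%:C * L2_repr u x) + (m x)%:C * L2_repr v x}.
    apply: filterS3 rhsE (L2_classE (mulop_fun (L2_repr u)))
      (L2_classE (mulop_fun (L2_repr v))) => x -> E1 E2.
    by rewrite /mu' /mv' E1 E2.
  apply: filterS2 lhsE rhsE' => x E1 E2.
  rewrite E1; apply: etrans (esym E2).
  by rewrite mulrDr mulrCA.
exists 1 => u; rewrite mul1r !L2_normE lecR -lee_fin !L2_norm_fineK.
rewrite (@ae_eq_N2 _ _ _ nu _ (mulop_fun (L2_repr u))).
- by apply: m_le; exact: L2fun_cmeasurable.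
- exact: L2fun_cmeasurable.
- exact: L2fun_cmeasurable.
- exact: L2_classE.
Qed.

Definition mulop : bounded_op (L2 mu) (L2 nu) := BoundedOp mulop_subproof.

Lemma mulopE (u : L2 mu) : {ae nu, forall x, (mulop u : L2 nu) x = (m x)%:C * u x}.
Proof. exact: L2_classE. Qed.

End multiplication_operator.

Section inner_product.
Context d (T : measurableType d) (R : realType).
Variable mu : {measure set T -> \bar R}.

Definition L2_dot (u v : L2 mu) : R[i] :=
  (\int[mu]_x complex.Re (u x * conjc (v x))) +i*
  (\int[mu]_x complex.Im (u x * conjc (v x))).

Lemma L2_dot_norm (u : L2 mu) : L2_dot u u = `|u| ^+ 2.
Proof.
rewrite /L2_dot L2_normE.
have -> : (fun x => complex.Re (u x * conjc (u x))) = (fun x => modulus u x ^+ 2).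
  apply/funext => x; rewrite sqr_modulus; case: (u x) => a b /=.
  by rewrite mulrN opprK.
have -> : (fun x => complex.Im (u x * conjc (u x))) = cst 0.
  by apply/funext => x; case: (u x) => a b /=; rewrite mulrN mulrC addNr.
rewrite /Rintegral sqr_integralE integral0/=.
rewrite -L2_norm_fineK poweR_EFin /= powR_mulrn ?fine_ge0 ?N2_ge0//.
by rewrite -[RHS]rmorphXn.
Qed.

Lemma ae_eq_L2_dot (u v u' v' : L2 mu) :
  {ae mu, forall x, u x * conjc (v x) = u' x * conjc (v' x)} ->
  L2_dot u v = L2_dot u' v'.
Proof.
have mJ (w : L2 mu) : cmeasurable (fun x => conjc (w x)).
  have [wr wi] := L2fun_cmeasurable (L2_repr w); split.
    rewrite (_ : (fun x => _) = fun x => complex.Re (w x))//.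
    by apply/funext => x; case: (w x).
  rewrite (_ : (fun x => _) = fun x => - complex.Im (w x)).
    by apply: measurableT_comp.
  by apply/funext => x; case: (w x).
have m2 (w z : L2 mu) : cmeasurable (fun x => w x * conjc (z x)).
  exact: cmeasurableM (L2fun_cmeasurable (L2_repr w)) (mJ z).
move=> uv; rewrite /L2_dot /Rintegral; congr (fine _ +i* fine _).
- apply: ae_eq_integral => //.
  + by apply/measurable_EFinP; have [] := m2 u v.
  + by apply/measurable_EFinP; have [] := m2 u' v'.
  + by apply: filterS uv => x -> _.
- apply: ae_eq_integral => //.
  + by apply/measurable_EFinP; have [] := m2 u v.
  + by apply/measurable_EFinP; have [] := m2 u' v'.
  + by apply: filterS uv => x -> _.
Qed.

End inner_product.

Section density.
Context d (T : measurableType d) (R : realType).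
Variable mu : {measure set T -> \bar R}.

(* A representative of a class in L^1(mu) that is a.e. real and nonnegative and
   has integral 1; everything below depends on rho only through its a.e.
   class. *)
Record density := Density {
  density_fun :> T -> R ;
  density_integrable : mu.-integrable setT (EFin \o density_fun) ;
  density_ge0 : {ae mu, forall x, 0 <= density_fun x} ;
  density_integral1 : (\int[mu]_x (density_fun x)%:E = 1)%E }.

Variable rho : density.

Lemma measurable_density : measurable_fun setT rho.
Proof. by apply/measurable_EFinP; exact: measurable_int (density_integrable rho). Qed.

Let g x : \bar R := (Num.max (rho x) 0)%:E.

Let mg : measurable_fun setT g.
Proof.
apply/measurable_EFinP; apply: measurable_maxr; last exact: measurable_cst.
exact: measurable_density.
Qed.

Let g_ge0 x : (0 <= g x)%E.
Proof. by rewrite lee_fin le_max lexx orbT. Qed.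

(* The measure rho dmu. Since rho is only a.e. nonnegative, taking the positive
   part makes the set function nonnegative on the nose; see weightedE. *)
Definition weighted (A : set T) : \bar R :=
  (\int[mu]_(x in A) (Num.max (rho x) 0)%:E)%E.

Lemma weightedE A : measurable A -> weighted A = (\int[mu]_(x in A) (rho x)%:E)%E.
Proof.
move=> mA; apply: ae_eq_integral => //.
- by apply: measurable_funTS; exact: mg.
- by apply: measurable_funTS; apply/measurable_EFinP; exact: measurable_density.
- by apply: filterS (density_ge0 rho) => x x0 _; rewrite max_l.
Qed.

Let weighted0 : weighted set0 = 0%E.
Proof. by rewrite /weighted integral_set0. Qed.

Let weighted_ge0 A : (0 <= weighted A)%E.
Proof. by apply: integral_ge0 => x _; exact: g_ge0. Qed.

Let weighted_sigma_additive : semi_sigma_additive weighted.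
Proof.
move=> F mF tF mUF.
have -> : weighted (\bigcup_k F k) = (\sum_(k <oo) weighted (F k))%E.
  apply: (@ge0_integral_bigcup _ _ _ mu F g) => //.
  by apply: (@measurable_funTS _ _ _ _ _ g); exact: mg.
by apply: is_cvg_nneseries => n _ _; exact: weighted_ge0.
Qed.

HB.instance Definition _ := isMeasure.Build _ _ _ weighted
  weighted0 weighted_ge0 weighted_sigma_additive.

Import HBNNSimple.

Lemma integral_weighted (f : T -> \bar R) : (forall x, 0 <= f x)%E ->
  measurable_fun setT f ->
  (\int[weighted]_x f x = \int[mu]_x (f x * (Num.max (rho x) 0)%:E))%E.
Proof.
move=> f0 mf; pose h := nnsfun_approx measurableT mf.
have -> : (\int[weighted]_x f x =
    lim (\int[weighted]_x (EFin \o h n) x @[n --> \oo]))%E.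
  have fE x : f x = lim ((EFin \o h n) x @[n --> \oo]).
    by apply/esym/cvg_lim => //; exact: cvg_nnsfun_approx.
  under eq_integral => x _ do rewrite fE.
  apply: monotone_convergence => //.
  - by move=> n; apply/measurable_EFinP; exact: measurable_funPT.
  - by move=> n x _ //=; rewrite lee_fin.
  - by move=> x _ a b ab; rewrite lee_fin; exact/lefP/nd_nnsfun_approx.
have -> : (\int[mu]_x (f x * g x) =
    lim (\int[mu]_x ((EFin \o h n) \* g) x @[n --> \oo]))%E.
  have fg x : (f x * g x = lim (((EFin \o h n) \* g) x @[n --> \oo]))%E.
    by apply/esym/cvg_lim => //; apply: cvgeZr => //; exact: cvg_nnsfun_approx.
  under eq_integral => x _ do rewrite fg.
  apply: monotone_convergence => [//| | |].
  - by move=> n; apply/emeasurable_funM => //; exact/measurable_EFinP.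
  - by move=> n x _ /=; apply: mule_ge0; [rewrite lee_fin|exact: g_ge0].
  - move=> x _ a b ab/=; apply: lee_wpmul2r; first exact: g_ge0.
    by rewrite lee_fin; exact/lefP/nd_nnsfun_approx.
suff suf n : (\int[mu]_x ((EFin \o h n) x * g x) =
    \int[weighted]_x (EFin \o h n) x)%E.
  by congr (limn _); apply/funext => n; rewrite -suf.
transitivity (\int[weighted]_x
   (\sum_(y \in range (h n)) (y * \1_(h n @^-1` [set y]) x)%:E))%E; last first.
  by apply: eq_integral => t _; rewrite /= fimfunE -fsumEFin.
have indich r : measurable_fun setT (fun x => (r * \1_(h n @^-1` [set r]) x)%:E).
  by apply/measurable_EFinP; exact: measurable_funM.
rewrite ge0_integral_fsum//; last by move=> m y _; exact: nnfun_muleindic_ge0.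
transitivity (\int[mu]_x (\sum_(y \in range (h n))
    (y * \1_(h n @^-1` [set y]) x)%:E * g x))%E.
  under [RHS]eq_integral => x xE.
    rewrite -ge0_mule_fsuml => [|y]; last exact: nnfun_muleindic_ge0.
    rewrite fsumEFin // -(fimfunE _ x); over.
  by [].
rewrite ge0_integral_fsum//; last 2 first.
  - by move=> y; exact: emeasurable_funM.
  - by move=> m y _; rewrite mule_ge0 ?g_ge0// nnfun_muleindic_ge0.
apply: eq_fsbigr => r rhn.
under [RHS]eq_integral do rewrite EFinM.
rewrite integralZl_indic_nnsfun => //.
under eq_integral do rewrite EFinM -muleA.
rewrite ge0_integralZl//.
- under eq_integral do rewrite muleC.
  rewrite (eq_integral (g \_ (h n @^-1` [set r]))); last first.
    by move=> x xE; rewrite epatch_indic.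
  by rewrite -integral_mkcondr setTI integral_indic// setIT.
- by apply: emeasurable_funM => //; exact/measurable_EFinP.
- by move=> t _; apply: mule_ge0; [rewrite lee_fin|exact: g_ge0].
- by move: rhn; rewrite inE => -[t _ <-]; rewrite lee_fin.
Qed.

End density.

Section aligned.
Context d (T : measurableType d) (R : realType).
Variable mu : {measure set T -> \bar R}.
Variable rho : density mu.

Local Notation H := (L2 mu).
Local Notation Hrho := (L2 (weighted rho)).

Definition Vrho_pred : {pred H} := fun u =>
  `[< {ae mu, forall x, rho x = 0 -> L2_repr u x = 0} >].

Definition Zrho_pred : {pred H} := fun u =>
  `[< {ae mu, forall x, 0 < rho x -> L2_repr u x = 0} >].

Let vanishing_submod_closed (P : T -> Prop) : submod_closed
  (fun u : H => `[< {ae mu, forall x, P x -> L2_repr u x = 0} >]).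
Proof.
split=> [|a u v /asboolP u0 /asboolP v0]; apply/asboolP.
  by apply: filterS (L2_zeroE mu) => x ->.
apply: filterS2 (filterI u0 v0) (filterI (L2_addE (a *: u) v) (L2_scaleE a u)).
by move=> x [ux vx] [-> ->] Px; rewrite ux// vx// mulr0 addr0.
Qed.

HB.instance Definition _ := GRing.isSubmodClosed.Build R[i] H
  Vrho_pred (vanishing_submod_closed (fun x => rho x = 0)).

HB.instance Definition _ := GRing.isSubmodClosed.Build R[i] H
  Zrho_pred (vanishing_submod_closed (fun x => 0 < rho x)).

Definition Vrho := subspace_of Vrho_pred.
Definition Zrho := subspace_of Zrho_pred.
HB.instance Definition _ := NormedModule.on Vrho.
HB.instance Definition _ := NormedModule.on Zrho.

Definition sqrt_density (x : T) : R := Num.sqrt (rho x).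

(* Equal to 0 where rho <= 0, because 0^-1 = 0. *)
Definition inv_sqrt_density (x : T) : R := (Num.sqrt (rho x))^-1.

Definition pos_density (x : T) : R := \1_[set y | 0 < rho y] x.

Lemma measurable_sqrt_density : measurable_fun setT sqrt_density.
Proof.
rewrite (_ : sqrt_density = @Num.sqrt R \o rho)//; apply: measurableT_comp.
  exact: continuous_measurable_fun (@sqrt_continuous R).
exact: measurable_density.
Qed.

Lemma measurable_inv_sqrt_density : measurable_fun setT inv_sqrt_density.
Proof.
rewrite (_ : inv_sqrt_density = (@powR R ^~ (-1)) \o sqrt_density).
  apply: measurableT_comp; first exact: measurable_powR.
  exact: measurable_sqrt_density.
by apply/funext => x /=; rewrite powR_inv1// sqrtr_ge0.
Qed.

Lemma measurable_pos_density : measurable_fun setT pos_density.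
Proof.
apply: measurable_indic.
rewrite (_ : [set _ | _] = setT `&` rho @^-1` `]0, +oo[%classic).
  exact: measurable_density.
by apply/seteqP; split=> x /=; rewrite in_itv/= andbT// => -[].
Qed.

Lemma N2_weighted (f : T -> R[i]) : cmeasurable f ->
  N2 (weighted rho) f = N2 mu (fun x => (sqrt_density x)%:C * f x).
Proof.
move=> mf; rewrite !N2E integral_weighted//; last 2 first.
- by move=> x; rewrite lee_fin sqr_ge0.
- exact: measurable_sqr_modulus.
congr (_ `^ _)%E; apply: eq_integral => x _.
rewrite -EFinM; congr (_%:E).
have -> : Num.max (rho x) 0 = sqrt_density x ^+ 2.
  rewrite /sqrt_density; have [r0|r0] := leP 0 (rho x).
    by rewrite sqr_sqrtr.
  by rewrite ler0_sqrtr ?ltW// expr0n.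
rewrite -exprMn; congr (_ ^+ 2); rewrite /modulus Normc.normcM mulrC.
by congr (_ * _); rewrite /= expr0n /= addr0 sqrtr_sqr ger0_norm// sqrtr_ge0.
Qed.

Lemma modulusM_le (m : T -> R) (f : T -> R[i]) x : 0 <= m x <= 1 ->
  modulus (fun y => (m y)%:C * f y) x <= modulus f x.
Proof.
move=> /andP[m0 m1]; rewrite /modulus Normc.normcM ler_piMl//.
  exact: (modulus_ge0 f).
by rewrite /= expr0n /= addr0 sqrtr_sqr ger0_norm.
Qed.

Lemma sqrt_densityVK x :
  sqrt_density x * inv_sqrt_density x = pos_density x.
Proof.
rewrite /sqrt_density /inv_sqrt_density /pos_density indicE.
have [r0|r0] := ltP 0 (rho x).
  by rewrite mem_set// mulfV// gt_eqF// sqrtr_gt0.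
rewrite memNset/=; last by apply/negP; rewrite -leNgt.
by rewrite ler0_sqrtr// mul0r.
Qed.

Lemma pos_density01 x : 0 <= pos_density x <= 1.
Proof. by rewrite /pos_density indicE ler0n lern1 leq_b1. Qed.

Lemma sqrt_density_le (f : T -> R[i]) : cmeasurable f ->
  (N2 mu (fun x => (sqrt_density x)%:C * f x)%R <= N2 (weighted rho) f)%E.
Proof. by move=> mf; rewrite N2_weighted. Qed.

Lemma pos_density_le (f : T -> R[i]) : cmeasurable f ->
  (N2 mu (fun x => (pos_density x)%:C * f x)%R <= N2 mu f)%E.
Proof.
move=> mf; apply: le_N2 => //.
  apply: cmeasurableM => //; apply: cmeasurable_real.
  exact: measurable_pos_density.
by move=> x; apply: modulusM_le; exact: pos_density01.
Qed.

Lemma inv_sqrt_density_le (f : T -> R[i]) : cmeasurable f ->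
  (N2 (weighted rho) (fun x => (inv_sqrt_density x)%:C * f x)%R <= N2 mu f)%E.
Proof.
move=> mf; rewrite N2_weighted; last first.
  apply: cmeasurableM => //; apply: cmeasurable_real.
  exact: measurable_inv_sqrt_density.
rewrite (_ : (fun x => _) = (fun x => (pos_density x)%:C * f x)).
  exact: pos_density_le.
by apply/funext => x; rewrite mulrA -realCM sqrt_densityVK.
Qed.

Definition mul_sqrt_density : bounded_op Hrho H :=
  mulop measurable_sqrt_density sqrt_density_le.

Definition Qrho : bounded_op H H :=
  mulop measurable_pos_density pos_density_le.

Lemma mul_sqrt_density_Vrho f : mul_sqrt_density f \in Vrho_pred.
Proof.
apply/asboolP; apply: filterS (mulopE measurable_sqrt_density sqrt_density_le f).
by move=> x -> r0; rewrite /sqrt_density r0 sqrtr0 mul0r.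
Qed.

Lemma Qrho_Vrho u : Qrho u \in Vrho_pred.
Proof.
apply/asboolP; apply: filterS (mulopE measurable_pos_density pos_density_le u).
move=> x -> r0; rewrite /pos_density indicE memNset ?mul0r//=.
by rewrite r0 ltxx.
Qed.

Definition Urho : bounded_op Hrho Vrho := corestrict mul_sqrt_density_Vrho.

(* U_rho^-1 v = [v / sqrt rho]; see Urho_invK and UrhoK below. *)
Definition Urho_inv : bounded_op Vrho Hrho :=
  mulop measurable_inv_sqrt_density inv_sqrt_density_le \oB
  subspace_incl Vrho_pred.

(* Q_rho with codomain V_rho *)
Definition projV : bounded_op H Vrho := corestrict Qrho_Vrho.

Definition inclV : bounded_op Vrho H := subspace_incl Vrho_pred.

Lemma Urho_norm f : `|Urho f| = `|f|.
Proof.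
rewrite subspace_normE /= !L2_normE; congr ((fine _)%:C).
rewrite N2_weighted; last exact: L2fun_cmeasurable.
apply: ae_eq_N2.
- exact: L2fun_cmeasurable.
- apply: cmeasurableM; last exact: L2fun_cmeasurable.
  by apply: cmeasurable_real; exact: measurable_sqrt_density.
- exact: (mulopE measurable_sqrt_density sqrt_density_le f).
Qed.

Lemma Urho_invK : cancel Urho_inv Urho.
Proof.
move=> v; apply: val_inj => /=; apply/L2_eqP.
have v0 : {ae mu, forall x, rho x = 0 -> L2_repr (subspace_val v) x = 0}.
  by have /asboolP := subspace_valP v.
have h := mulop_fun_ae measurable_sqrt_density sqrt_density_le
  (mulopE measurable_inv_sqrt_density inv_sqrt_density_le (subspace_val v)
   : {ae weighted rho, forall x, _ = mulop_fun measurable_inv_sqrt_density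
       inv_sqrt_density_le (L2_repr (subspace_val v)) x}).
have e := mulopE measurable_sqrt_density sqrt_density_le (Urho_inv v).
apply: filterS3 (filterI v0 (density_ge0 rho)) h e => x [v0x r0] hx ex.
apply: (etrans ex); apply: (etrans hx) => /=.
rewrite mulrA -realCM sqrt_densityVK /pos_density indicE.
have [rx|rx] := eqVneq (rho x) 0; first by rewrite v0x// mulr0.
by rewrite mem_set ?mul1r//= lt_neqAle eq_sym rx.
Qed.

Lemma UrhoK : cancel Urho Urho_inv.
Proof.
move=> f; apply/eqP; rewrite -subr_eq0 -normr_eq0 -Urho_norm.
have -> : Urho (Urho_inv (Urho f) - f) = Urho (Urho_inv (Urho f)) - Urho f.
  exact: linearB.
by rewrite Urho_invK subrr normr0.
Qed.

Lemma Qrho_id (v : H) : v \in Vrho_pred -> Qrho v = v.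
Proof.
move=> /asboolP v0; apply/L2_eqP.
have e := mulopE measurable_pos_density pos_density_le v.
apply: filterS3 v0 (density_ge0 rho) e => x v0x r0 ->.
rewrite /pos_density indicE.
have [rx|rx] := eqVneq (rho x) 0; first by rewrite v0x// mulr0.
by rewrite mem_set ?mul1r//= lt_neqAle eq_sym rx.
Qed.

(* Z_rho is the orthogonal complement of V_rho. *)
Lemma Zrho_dot (u : H) :
  u \in Zrho_pred <-> forall v, v \in Vrho_pred -> L2_dot u v = 0.
Proof.
split=> [/asboolP u0 v /asboolP v0|uV].
  rewrite (@ae_eq_L2_dot _ _ _ mu _ _ 0 0).
    by rewrite L2_dot_norm normr0 expr0n.
  apply: filterS3 (filterI u0 v0) (density_ge0 rho) (L2_zeroE mu).
  move=> x [ux vx] r0 ->; rewrite mul0r.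
  have [rx|rx] := eqVneq (rho x) 0; first by rewrite vx// conjc0 mulr0.
  by rewrite ux ?mul0r// lt_neqAle eq_sym rx.
have e := mulopE measurable_pos_density pos_density_le u.
have := uV _ (Qrho_Vrho u).
rewrite (@ae_eq_L2_dot _ _ _ mu _ _ (Qrho u) (Qrho u)).
  rewrite L2_dot_norm => /eqP; rewrite expf_eq0/= normr_eq0 => /eqP Q0.
  have {}e : {ae mu, forall x, L2_repr (0 : H) x = (pos_density x)%:C * L2_repr u x}.
    by rewrite -Q0; exact: e.
  apply/asboolP; apply: filterS2 e (L2_zeroE mu) => x -> + rx.
  by rewrite /pos_density indicE mem_set//= mul1r.
apply: filterS e => x ->; rewrite rmorphM/=.
rewrite /pos_density indicE; case: (_ \in _) => /=.
  by rewrite oppr0 !mul1r.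
by rewrite oppr0 !mul0r mulr0.
Qed.

Lemma Qrho_sub (u : H) : u - Qrho u \in Zrho_pred.
Proof.
have e := mulopE measurable_pos_density pos_density_le u.
have a := L2_addE u (- Qrho u).
have s := L2_scaleE (-1) (Qrho u); rewrite scaleN1r in s.
apply/asboolP; apply: filterS3 e a s => x ex -> -> rx.
by rewrite ex /pos_density indicE mem_set//= mul1r mulN1r subrr.
Qed.

Definition aligned (A : bounded_op Hrho Hrho) : bounded_op Vrho Vrho :=
  Urho \oB A \oB Urho_inv.

Definition ambient_ext (A : bounded_op Hrho Hrho) : set (bounded_op H H) :=
  [set E | forall v : Vrho, E (subspace_val v) = subspace_val (aligned A v)].

Definition zero_defect_ext (A : bounded_op Hrho Hrho) : bounded_op H H :=
  inclV \oB aligned A \oB projV.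

Definition Nrho_pred : {pred bounded_op H H} := fun N =>
  `[< N \oB Qrho = 0 >].

Lemma Nrho_submod_closed : submod_closed Nrho_pred.
Proof.
split=> [|a M N /asboolP M0 /asboolP N0]; apply/asboolP.
  by apply: bounded_opE => x.
apply: bounded_opE => x.
have M0x : M (Qrho x) = 0 by rewrite -[LHS]/((M \oB Qrho) x) M0.
have N0x : N (Qrho x) = 0 by rewrite -[LHS]/((N \oB Qrho) x) N0.
change (a *: M (Qrho x) + N (Qrho x) = 0).
by rewrite M0x N0x scaler0 addr0.
Qed.

HB.instance Definition _ := GRing.isSubmodClosed.Build R[i] (bounded_op H H)
  Nrho_pred Nrho_submod_closed.

Definition Nrho := subspace_of Nrho_pred.
HB.instance Definition _ := NormedModule.on Nrho.

End aligned.

(* R^n is [n.-tuple R] with the product sigma-algebra, which is the Borel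
   sigma-algebra (measurable_tuple_borel). Lebesgue measure on R^n is the n-fold
   product of Lebesgue measure on R (lebesgue_Rn_box). *)
Section lebesgue_Rn.
Variable R : realType.

Let behead_cons_tuple n (x : R) (t : n.-tuple R) :
  [tuple of behead [tuple of x :: t]] = t.
Proof. by apply: val_inj. Qed.

Section lebesgue_cons.
Variables (n : nat) (m : {sigma_finite_measure set (n.-tuple R) -> \bar R}).

Definition lebesgue_cons : set (n.+1.-tuple R) -> \bar R :=
  pushforward (@lebesgue_measure R \x m)%E
    (fun p : measurableTypeR R * n.-tuple R => [tuple of p.1 :: p.2]).

Let mcons : measurable_fun setT
  (fun p : measurableTypeR R * n.-tuple R => [tuple of p.1 :: p.2] : n.+1.-tuple R).
Proof. by apply: measurable_cons; [exact: measurable_fst|exact: measurable_snd]. Qed.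

Let cons0 : lebesgue_cons set0 = 0%E.
Proof. exact: measure0. Qed.

Let cons_ge0 A : (0 <= lebesgue_cons A)%E.
Proof. exact: measure_ge0. Qed.

Let cons_sigma_additive : semi_sigma_additive lebesgue_cons.
Proof.
move=> F mF tF mUF; rewrite /lebesgue_cons /pushforward preimage_bigcup.
apply: measure_semi_sigma_additive.
- by move=> k; rewrite -[X in measurable X]setTI; exact: mcons.
- apply/trivIsetP => /= i j _ _ ij; rewrite -preimage_setI.
  by move/trivIsetP : tF => /(_ _ _ _ _ ij) ->//; rewrite preimage_set0.
- by rewrite -preimage_bigcup -[X in measurable X]setTI; exact: mcons.
Qed.

HB.instance Definition _ := isMeasure.Build _ _ _ lebesgue_cons
  cons0 cons_ge0 cons_sigma_additive.

Let uncons (t : n.+1.-tuple R) : measurableTypeR R * n.-tuple R :=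
  (tnth t ord0, [tuple of behead t]).

Let muncons : measurable_fun setT uncons.
Proof.
apply: measurable_fun_pair; first exact: measurable_tnth.
exact: measurable_behead.
Qed.

Let cons_sigma_finite : sigma_finite setT lebesgue_cons.
Proof.
have /sigma_finiteP[F [TF ndF Foo]] := sigma_finiteT (@lebesgue_measure R).
have /sigma_finiteP[G [TG ndG Goo]] := sigma_finiteT m.
have GT : [set: measurableTypeR R * n.-tuple R] = \bigcup_k (F k `*` G k).
  rewrite -setXTT TF TG predeqE => -[x y]; split.
    move=> [/= [i _ Fix_] [j _ Gjy]]; exists (maxn i j) => //; split.
    - by move: x Fix_; exact/subsetPset/ndF/leq_maxl.
    - by move: y Gjy; exact/subsetPset/ndG/leq_maxr.
  by move=> [i _ []/= ? ?]; split; exists i.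
exists (fun k => uncons @^-1` (F k `*` G k)).
  by rewrite -preimage_bigcup -GT preimage_setT.
move=> k; have [mF Fk] := Foo k; have [mG Gk] := Goo k.
have mFG : measurable (F k `*` G k) by exact: measurableX.
split.
  by rewrite -[X in measurable X]setTI; exact: muncons.
rewrite /lebesgue_cons /pushforward (_ : _ @^-1` _ = F k `*` G k).
  by rewrite product_measure1E// lte_mul_pinfty// ge0_fin_numE.
by apply/seteqP; split => -[x t] /= []; rewrite behead_cons_tuple.
Qed.

HB.instance Definition _ := Measure_isSigmaFinite.Build _ _ _ lebesgue_cons
  cons_sigma_finite.

Lemma lebesgue_cons_box (A : set R) (B : set (n.-tuple R)) :
  measurable A -> measurable B ->
  lebesgue_cons [set t | A (tnth t ord0) /\ B [tuple of behead t]] =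
  (lebesgue_measure A * m B)%E.
Proof.
move=> mA mB; rewrite -product_measure1E//.
rewrite /lebesgue_cons /pushforward; congr (_ _).
by apply/seteqP; split => -[x t] /= []; rewrite behead_cons_tuple.
Qed.

End lebesgue_cons.

Fixpoint lebesgue_Rn (n : nat) : {sigma_finite_measure set (n.-tuple R) -> \bar R} :=
  if n is n'.+1 then lebesgue_cons (lebesgue_Rn n') else \d_([tuple] : 0.-tuple R).

Lemma lebesgue_Rn_box (n : nat) (B : 'I_n -> set R) :
  (forall i, measurable (B i)) ->
  lebesgue_Rn n [set t | forall i, B i (tnth t i)] =
  (\prod_(i < n) lebesgue_measure (B i))%E.
Proof.
elim: n => [|n IHn] in B *.
  move=> _; rewrite big_ord0 /= diracE.
  by rewrite (_ : _ \in _ = true)//; apply/mem_set => -[].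
move=> mB. rewrite big_ord_recl -IHn//=.
have mC : measurable [set t : n.-tuple R | forall i, B (lift ord0 i) (tnth t i)].
  rewrite (_ : [set _ | _] = \bigcap_(i in [set: 'I_n])
      ((fun t : n.-tuple R => tnth t i) @^-1` B (lift ord0 i))).
    apply: fin_bigcap_measurable => // i _; rewrite -[X in measurable X]setTI.
    exact: measurable_tnth.
  by apply/seteqP; split => t /= Bt i; [move=> _; exact: Bt|exact: Bt].
rewrite -lebesgue_cons_box//; congr (_ _).
apply/seteqP; split => t /=.
  move=> Bt; split=> // i.
  have := Bt (lift ord0 i); congr (B _ _).
  by rewrite !(tnth_nth 0) /= nth_behead.
move=> [B0 Bt] i; case: (unliftP ord0 i) => [j ->|->//].
have := Bt j; congr (B _ _).
by rewrite !(tnth_nth 0) /= nth_behead.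
Qed.

End lebesgue_Rn.

Section borel_Rn.
Variables (R : realType) (n : nat).

Let row_of (t : n.-tuple R) : 'rV[R]_n := \row_i tnth t i.

Definition open_preimages : set (set (n.-tuple R)) :=
  [set A | exists2 U : set 'rV[R]_n, open U & A = row_of @^-1` U].

Let box (ab : n.-tuple rat * n.-tuple rat) : set (n.-tuple R) :=
  [set t | forall i, ratr (tnth ab.1 i) < tnth t i < ratr (tnth ab.2 i)].

Let measurable_box ab : measurable (box ab).
Proof.
rewrite (_ : box ab = \bigcap_(i in [set: 'I_n]) ((fun t => tnth t i) @^-1`
    `]ratr (tnth ab.1 i), ratr (tnth ab.2 i)[%classic)).
  apply: fin_bigcap_measurable => // i _; rewrite -[X in measurable X]setTI.
  exact: measurable_tnth.
apply/seteqP; split => t /= tab i; first by move=> _ /=; rewrite in_itv/=.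
by have := tab i I; rewrite /= in_itv.
Qed.

Let open_box_cover (U : set 'rV[R]_n) : open U ->
  row_of @^-1` U = \bigcup_ab (if `[< box ab `<=` row_of @^-1` U >] then box ab else set0).
Proof.
move=> oU; apply/seteqP; split => [t Ut|t [ab _]]; last first.
  by case: asboolP => // sU abt; exact: sU.
have [e /= e0 eU] : exists2 e : R, 0 < e & ball (row_of t) e `<=` U.
  have := open_nbhs_nbhs (conj oU Ut).
  by rewrite -nbhs_ballE => -[e e0 eU]; exists e.
have lo i : {q : rat | tnth t i - e < ratr q < tnth t i}.
  have /cid[q] : exists q : rat, ratr q \in `]tnth t i - e, tnth t i[.
    by apply: rat_in_itvoo; rewrite gtrBl.
  by rewrite in_itv/= => ?; exists q.
have hi i : {q : rat | tnth t i < ratr q < tnth t i + e}.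
  have /cid[q] : exists q : rat, ratr q \in `]tnth t i, tnth t i + e[.
    by apply: rat_in_itvoo; rewrite ltrDl.
  by rewrite in_itv/= => ?; exists q.
pose ab := ([tuple sval (lo i) | i < n], [tuple sval (hi i) | i < n]).
exists ab => //; case: asboolP => [_|nsub]; last first.
  case: nsub => s st; apply: eU; split=> // i j.
  rewrite !mxE /ball/=; have := st j; rewrite !tnth_mktuple.
  have /andP[lo1 lo2] := svalP (lo j); have /andP[hi1 hi2] := svalP (hi j).
  move=> /andP[s1 s2]; rewrite ltr_distlC.
  rewrite (lt_trans lo1 s1)/= (lt_trans s2)//.
by move=> i /=; rewrite !tnth_mktuple; case/andP: (svalP (lo i)) => _ ->;
  case/andP: (svalP (hi i)).
Qed.

Lemma measurable_tuple_borel :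
  @measurable _ (n.-tuple R) = <<s open_preimages >>.
Proof.
apply/seteqP; split; last first.
  apply: smallest_sub; first exact: sigma_algebra_measurable.
  move=> _ [U oU ->]; rewrite open_box_cover//.
  apply: countable_bigcupT_measurable; first exact: countableP.
  by move=> ab; case: ifPn => // _; exact: measurable_box.
have mT i : @measurable_fun _ _ (g_sigma_algebraType open_preimages) R setT
    (fun t : n.-tuple R => tnth t i).
  apply: (measurability _ (RGenOpens.measurableE R)).
  move=> _ [_ [x [y ->]] <-]; rewrite setTI; apply: sub_sigma_algebra.
  exists ((fun v : 'rV[R]_n => v ord0 i) @^-1` `]x, y[%classic).
    by apply: open_comp; [move=> v _; exact: coord_continuous|exact: interval_open].
  by apply/seteqP; split => t /=; rewrite mxE.
have mid := (measurable_fun_tnthP (fun t : g_sigma_algebraType open_preimages =>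
  (t : n.-tuple R))).2 mT.
move=> A mA; have := mid measurableT _ mA; rewrite setTI.
exact.
Qed.

End borel_Rn.

(* Main.v *)
(* With P := 1 - Q_rho, the contraction of L^2(mu) onto Z_rho that multiplies by
   the indicator of the complement of {rho > 0}, the isometry is B |-> B P: it is
   norm nonincreasing because P is, and N |-> N|Z_rho is a norm nonincreasing
   inverse. Two operators that agree on V_rho = range Q_rho differ by an element
   of N_rho, which gives the description of the ambient extensions. *)
Require Import Defs.
From HB Require Import structures.
From mathcomp Require Import all_boot all_order all_algebra.
From mathcomp Require Import complex.
From mathcomp Require Import all_classical all_reals all_analysis.
From mathcomp Require Import measurable_realfun.

Import Order.TTheory GRing.Theory Num.Theory.
Import numFieldNormedType.Exports.

Local Open Scope classical_set_scope.
Local Open Scope ring_scope.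

Lemma bounded_opBE (R : realType) (E F : normedModType R[i])
    (f g : bounded_op E F) x :
  (f - g) x = f x - g x.
Proof. by []. Qed.

(** The isometry needs the constant 1 for [Prho], whereas [bounded_op] only records that some bound
    exists. The hypothesis [m_le] gives it, as [N2] is invariant under a.e. equality. *)
Lemma ler_norm_mulop d (T : measurableType d) (R : realType)
    (mu nu : {measure set T -> \bar R}) (m : T -> R)
    (mm : measurable_fun setT m)
    (m_le : forall f : T -> R[i], cmeasurable f ->
      (N2 nu (fun x => (m x)%:C%C * f x)%R <= N2 mu f)%E) (u : L2 mu) :
  `|mulop mm m_le u| <= `|u|.
Proof.
rewrite !L2_normE lecR -lee_fin !L2_norm_fineK.
rewrite (@ae_eq_N2 _ _ _ nu _ (mulop_fun mm m_le (L2_repr u))).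
- by apply: m_le; exact: L2fun_cmeasurable.
- exact: L2fun_cmeasurable.
- exact: L2fun_cmeasurable.
- exact: L2_classE.
Qed.

Section ambient_extensions.
Context {d} {T : measurableType d} {R : realType}.
Context {mu : {measure set T -> \bar R}} (rho : density mu).

Local Notation H := (L2 mu).
Local Notation Hrho := (L2 (weighted rho)).

Definition null_density (x : T) : R := 1 - pos_density rho x.

Lemma measurable_null_density : measurable_fun setT null_density.
Proof.
apply: measurable_funB; first exact: measurable_cst.
exact: measurable_pos_density.
Qed.

Lemma null_density_le (f : T -> R[i]) : cmeasurable f ->
  (N2 mu (fun x => (null_density x)%:C%C * f x)%R <= N2 mu f)%E.
Proof.
move=> mf; apply: le_N2 => //.
  apply: cmeasurableM => //; apply: cmeasurable_real.
  exact: measurable_null_density.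
move=> x; apply: modulusM_le; have /andP[p0 p1] := pos_density01 rho x.
by rewrite /null_density subr_ge0 p1 lerBlDr lerDl.
Qed.

(** Built as a multiplication operator, not as a difference, so that contractivity follows from a
    multiplier with values in [0, 1]; the triangle inequality would only give 2. *)
Definition Prho : bounded_op H H :=
  mulop measurable_null_density null_density_le.

Lemma PrhoE (u : H) : Prho u = u - Qrho rho u.
Proof.
apply/L2_eqP.
have p := mulopE measurable_null_density null_density_le u.
have q := mulopE (measurable_pos_density rho) (@pos_density_le _ _ _ _ rho) u.
have a := L2_addE u (- Qrho rho u).
(* The a.e. values of [- Qrho rho u] are read off from scaling by -1. *)
have s := L2_scaleE (-1) (Qrho rho u); rewrite scaleN1r in s.
apply: filterS3 (filterI p q) a s => x [px qx] ax sx.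
apply: (etrans px); rewrite ax sx qx /null_density mulN1r.
by rewrite rmorphB/= rmorph1 mulrBl mul1r.
Qed.

Lemma Prho_Zrho (u : H) : Prho u \in Zrho_pred rho.
Proof. by rewrite PrhoE; exact: Qrho_sub. Qed.

Definition projZ : bounded_op H (Zrho rho) := corestrict Prho_Zrho.

Definition inclZ : bounded_op (Zrho rho) H := subspace_incl (Zrho_pred rho).

Lemma Qrho_Zrho (u : H) : u \in Zrho_pred rho -> Qrho rho u = 0.
Proof.
move=> /asboolP u0; apply/L2_eqP.
have q := mulopE (measurable_pos_density rho) (@pos_density_le _ _ _ _ rho) u.
apply: filterS3 u0 q (L2_zeroE mu) => x u0x -> ->.
rewrite /pos_density indicE; case: (boolP (_ \in _)) => [/set_mem rx|_].
  by rewrite u0x// mulr0.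
by rewrite mul0r.
Qed.

Lemma inclZK : cancel inclZ projZ.
Proof.
move=> z; apply: val_inj; rewrite /= -[LHS]/(Prho (subspace_val z)) PrhoE.
by rewrite Qrho_Zrho ?subr0//; exact: subspace_valP.
Qed.

Lemma projZ_Qrho (u : H) : projZ (Qrho rho u) = 0.
Proof.
apply: val_inj; rewrite /= -[LHS]/(Prho (Qrho rho u)) PrhoE.
by rewrite (Qrho_id (Qrho_Vrho rho u)) subrr.
Qed.

(** [Qrho] maps into V_rho and fixes it pointwise, so its range is exactly V_rho. *)
Lemma NrhoP (N : bounded_op H H) :
  N \in Nrho_pred rho <->
  forall v, v \in Vrho_pred rho -> N v = 0.
Proof.
split=> [/asboolP N0 v vV|N0].
  by rewrite -(Qrho_id vV) -[LHS]/((N \oB Qrho rho) v) N0.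
by apply/asboolP; apply: bounded_opE => u; apply: N0; exact: Qrho_Vrho.
Qed.

Lemma comp_projZ_Nrho (B : bounded_op (Zrho rho) H) :
  B \oB projZ \in Nrho_pred rho.
Proof.
apply/asboolP; apply: bounded_opE => u.
by rewrite -[LHS]/(B (projZ (Qrho rho u))) projZ_Qrho linear0.
Qed.

Definition extZ (B : bounded_op (Zrho rho) H) : Nrho rho :=
  SubspaceOf (comp_projZ_Nrho B).

Lemma extZ_linear : linear extZ.
Proof. by move=> a B C; apply: val_inj; apply: bounded_opE. Qed.

HB.instance Definition _ := GRing.isLinear.Build R[i]
  (bounded_op (Zrho rho) H) (Nrho rho) _ extZ extZ_linear.

(** The inverse is restriction to Z_rho: P fixes Z_rho, and N Q_rho = 0 gives N P = N - N Q_rho =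
    N. *)
Lemma extZ_bij : bijective extZ.
Proof.
exists (fun N => subspace_val N \oB inclZ) => [B|N].
  by apply: bounded_opE => z; rewrite -[LHS]/(B (projZ (inclZ z))) inclZK.
apply: val_inj; apply: bounded_opE => u.
rewrite -[LHS]/(subspace_val N (Prho u)) PrhoE.
transitivity (subspace_val N u - subspace_val N (Qrho rho u)).
  exact: linearB.
by rewrite ((NrhoP _).1 (subspace_valP N) _ (Qrho_Vrho rho u)) subr0.
Qed.

Lemma extZ_norm (B : bounded_op (Zrho rho) H) : `|extZ B| = `|B|.
Proof.
rewrite subspace_normE !op_normE; apply/eqP; rewrite eq_le; apply/andP; split.
  apply: op_norm_le => [|u]; first exact: op_norm_ge0.
  apply: (le_trans (le_op_norm B (projZ u))).
  by rewrite ler_wpM2l ?op_norm_ge0// subspace_normE ler_norm_mulop.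
apply: op_norm_le => [|z]; first exact: op_norm_ge0.
(* Since P fixes z, B z is the value of B P at z, and the inclusion of Z_rho preserves norms. *)
rewrite -[z in B z]inclZK.
exact: (le_op_norm (B \oB projZ) (inclZ z)).
Qed.

Variable A : bounded_op Hrho Hrho.

Lemma ambient_ext_zero_defect : ambient_ext A (zero_defect_ext A).
Proof.
move=> v; rewrite -[LHS]/(subspace_val (aligned A (projV rho (subspace_val v)))).
congr (subspace_val (aligned A _)); apply: val_inj.
exact: (Qrho_id (subspace_valP v)).
Qed.

(** The base point E is arbitrary: the zero-defect extension yields the coset description, while
    transitivity of the translations compares any two extensions. *)
Lemma ambient_ext_sub (E F : bounded_op H H) : ambient_ext A E ->
  (ambient_ext A F <-> F - E \in Nrho_pred rho).
Proof.
move=> AE; rewrite NrhoP; split=> [AF v vV|FE v].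
  by rewrite bounded_opBE (AE (SubspaceOf vV)) (AF (SubspaceOf vV)) subrr.
by rewrite -AE; apply/eqP; rewrite -subr_eq0 -bounded_opBE FE//; exact: subspace_valP.
Qed.

Lemma ambient_ext_translate (E : bounded_op H H) : ambient_ext A E ->
  ambient_ext A = [set E + N | N in [set` Nrho_pred rho]].
Proof.
move=> AE; apply/seteqP; split=> [F AF|_ [N /= NN <-]].
  by exists (F - E); [exact/(ambient_ext_sub _ _ AE)|rewrite addrC subrK].
by apply/(ambient_ext_sub _ _ AE); rewrite addrC addKr.
Qed.

Lemma ambient_ext_affine :
  affine_space_modeled_on (fun B => subspace_val (extZ B)) (ambient_ext A).
Proof.
split=> [|E B AE|E F AE AF].
- by exists (zero_defect_ext A); exact: ambient_ext_zero_defect.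
- rewrite (ambient_ext_translate _ AE); exists (subspace_val (extZ B)) => //.
  exact: subspace_valP.
- have [r extZK rK] := extZ_bij.
  pose N : Nrho rho := SubspaceOf ((ambient_ext_sub _ _ AE).1 AF).
  (* The translation from E to F is the preimage of F - E under [extZ]; injectivity makes it
     unique. *)
  exists (r N); split=> [|B FE].
    by rewrite rK /= addrC subrK.
  rewrite -[RHS]extZK; congr r; apply: val_inj => /=.
  by rewrite FE addrC addKr.
Qed.

End ambient_extensions.

Theorem theorem5p2 (R : realType) (n : nat) (n_ge1 : (1 <= n)%N)
    (rho : density (lebesgue_Rn R n))
    (A : bounded_op (L2 (weighted rho)) (L2 (weighted rho))) :
  ambient_ext A = [set zero_defect_ext A + N | N in [set` Nrho_pred rho]] /\
  exists Psi : {linear bounded_op (Zrho rho) (L2 (lebesgue_Rn R n)) -> Nrho rho},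
    isometric_isomorphism Psi /\
    affine_space_modeled_on (fun B => subspace_val (Psi B)) (ambient_ext A).
Proof.
split; first exact: ambient_ext_translate _ _ _ (ambient_ext_zero_defect _ A).
exists (@extZ _ _ _ _ rho); split; last exact: ambient_ext_affine.
by split; [exact: extZ_bij|exact: extZ_norm].
Qed.
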